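(* (Extreme Value Theorem.) Let $X$ be a topological space (a type with an interior operator $\mathrm{int}_X$), $s:\mathcal P(X)$ and $f:X\to\mathcal C$. Then $\mathbf{Cpt}(s)\otimes\Big(\forall n:\mathbb N,\ x_{\_}:[n]\to X,\ \big(\bigotimes_{i:[n]}x_i\in s\multimap\exists x':X,(x'\in s\otimes\bigotimes_{i:[n]}f(x_i)\le f(x'))\big)\Big)\multimap\exists x':X,\Big(x'\in s\otimes\,!\forall x:X,\big(x\in s\multimap\mathbf{Conti}(f)\multimap f(x)\le f(x')\big)\Big),$ where $\mathcal C$ carries the topology generated by open intervals.
   Context: Framework: constructive mathematics with affine logic as internal logic (classical linear logic with weakening but without contraction). Connectives: $\otimes$ (multiplicative conjunction, unit $\top$), $\mathbin{\mathrm{par}}$ (multiplicative disjunction), $\mathbin{\&}$ (additive conjunction), $\oplus$ (additive disjunction), involutive negation $\neg$, $\multimap$ (right associative), exponentials $!,?$; $\forall,\exists$ usual (additive) quantifiers; $\otimes,\mathbin{\&}$ bind tighter than $\mathbin{\mathrm{par}},\oplus,\multimap$. $\Omega$ impredicative type of propositions, $\mathcal P(X):=X\to\Omega$, $x\in s$ means $s(x)$, $x\notin s$ means $\neg s(x)$, $s\subseteq t:=\forall x,(x\in s\multimap x\in t)$, $s^{\mathsf c}:=\{x\mid x\notin s\}$, $s\boxtimes t:=\{x\mid x\in s\otimes x\in t\}$, $s\sqcap t:=\{x\mid x\in s\mathbin{\&}x\in t\}$, $X$ also denotes $\{x\mid\top\}$. $[n]$ is the type of naturals below $n$ and $\bigotimes_{i:[n]}$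 the iterated $\otimes$ (empty one $\top$). Interior operator: $\mathrm{int}$ with, for all $s,t$, $\mathrm{int}\,s\subseteq s$; $s\subseteq t\multimap\mathrm{int}\,s\subseteq\mathrm{int}\,t$; $\mathrm{int}\,s\subseteq\mathrm{int}(\mathrm{int}\,s)$; $X\subseteq\mathrm{int}\,X$; $\mathrm{int}\,s\boxtimes\mathrm{int}\,t\subseteq\mathrm{int}(s\sqcap t)$. $\mathrm{cl}\,s:=(\mathrm{int}(s^{\mathsf c}))^{\mathsf c}$. Filter: $\mathbf{Fil}(\mathcal F):=\,!\big((\forall s,t,(s\in\mathcal F\multimap s\subseteq t\multimap t\in\mathcal F))\otimes X\in\mathcal F\otimes\forall s,t,(s\in\mathcal F\otimes t\in\mathcal F\multimap s\boxtimes t\in\mathcal F)\big)$. Compactness: $\mathbf{Cpt}(s):=\forall\mathcal F:\mathcal P(\mathcal P(X)),\ \mathbf{Fil}(\mathcal F)\multimap s^{\mathsf c}\notin\mathcal F\multimap\exists x:X,\big(x\in s\otimes\,!\forall t,(t\in\mathcal F\multimap x\in\mathrm{cl}\,t)\big)$. Continuity of $f:X\to Y$: $\mathbf{Conti}(f):=\forall t:\mathcal P(Y),\ f^{-1}(\mathrm{int}_Y t)\subseteq\mathrm{int}_X f^{-1}(t)$ with $f^{-1}(t):=t\circ f$. Cuts: $\mathcal C$ is the type of subsets $L:\mathcal P(\mathbb Q)$ that are lower sets ($\forall a,b,(a<b\otimes b\in L\multimap a\in L)$) and upwards-open ($\forall a,(a\in L\multimap\exists b,(a<b\otimes b\in L))$);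 $x_L$ denotes this subset for $x:\mathcal C$. $x\le y:=x_L\subseteq y_L$, $x<y:=\neg(y\le x)$; a rational $q$ is the cut $\{r\mid r<q\}$. Conventions $-\infty<x$, $x<\infty$ are $\top$. $\mathcal I:=(\mathbb Q\cup\{-\infty\})\times(\mathbb Q\cup\{\infty\})$ (additive union); $(a,b):=\{x:\mathcal C\mid a<x\otimes x<b\}$. The topology on $\mathcal C$: $\mathrm{int}_{\mathcal C}s:=\{x\mid\exists(a,b):\mathcal I,\ x\in(a,b)\otimes(a,b)\subseteq s\}$. *)

(* Defs.v *)
From mathcomp Require Import all_boot all_order all_algebra.
Set Implicit Arguments.
Unset Strict Implicit.
Unset Printing Implicit Defensive.
Import Order.TTheory GRing.Theory Num.Theory.

Declare Scope affine_scope.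
Delimit Scope affine_scope with A.
Local Open Scope affine_scope.

(* Shallow embedding of higher-order affine logic (classical linear logic with
   weakening).  An [affineLogic] is a type of propositions Omega with the
   connectives and a consequence relation closed under the rules of the logic;
   a context of hypotheses is represented by the tensor of its members.
   Quantifiers range over arbitrary types, in particular over Omega and over
   X -> Omega, which is the impredicativity of Omega.  An internal theorem is
   one that is entailed by [atop] in every [affineLogic]; nothing beyond the
   rules below is assumed.
   Weakening is [atopI]; contraction is available for [abang] only. *)
Record affineLogic := AffineLogic {
  Omega :> Type;
  entails : Omega -> Omega -> Prop;
  atop : Omega;
  abot : Omega;
  atens : Omega -> Omega -> Omega;
  alolli : Omega -> Omega -> Omega;
  awith : Omega -> Omega -> Omega;
  aplus : Omega -> Omega -> Omega;
  aall : forall I : Type, (I -> Omega) -> Omega;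
  aex : forall I : Type, (I -> Omega) -> Omega;
  abang : Omega -> Omega;
  entails_refl : forall a, entails a a;
  entails_trans : forall b a c, entails a b -> entails b c -> entails a c;
  atopI : forall a, entails a atop;
  atensS : forall a b c d,
    entails a b -> entails c d -> entails (atens a c) (atens b d);
  atensC : forall a b, entails (atens a b) (atens b a);
  atensA : forall a b c,
    entails (atens a (atens b c)) (atens (atens a b) c);
  atens1I : forall a, entails a (atens atop a);
  atens1E : forall a, entails (atens atop a) a;
  alolliP : forall a b c,
    entails (atens a b) c <-> entails a (alolli b c);
  (* negation, i.e. [alolli _ abot], is involutive *)
  adnegE : forall a, entails (alolli (alolli a abot) abot) a;
  awithP : forall a b c,
    entails a (awith b c) <-> entails a b /\ entails a c;
  aplusP : forall a b c,
    entails (aplus a b) c <-> entails a c /\ entails b c;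
  aallP : forall (I : Type) a (P : I -> Omega),
    entails a (aall P) <-> (forall i, entails a (P i));
  aexP : forall (I : Type) (P : I -> Omega) c,
    entails (aex P) c <-> (forall i, entails (P i) c);
  abangE : forall a, entails (abang a) a;
  abang_promote : forall a b,
    entails (abang a) b -> entails (abang a) (abang b);
  abang_top : entails atop (abang atop);
  abang_tens : forall a b,
    entails (atens (abang a) (abang b)) (abang (atens a b));
  abang_contract : forall a, entails (abang a) (atens (abang a) (abang a))
}.

Arguments atop {_}.
Arguments abot {_}.
Arguments aall {_ I} P.
Arguments aex {_ I} P.
Arguments entails_trans {_} b {a c}.

Definition aneg (L : affineLogic) (a : L) : L := alolli a abot.
Definition apar (L : affineLogic) (a b : L) : L :=
  aneg (atens (aneg a) (aneg b)).
Definition awhynot (L : affineLogic) (a : L) : L := aneg (abang (aneg a)).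

Notation "⊤" := atop : affine_scope.
Notation "⊥" := abot : affine_scope.
Notation "¬ a" := (aneg a) (at level 35, right associativity) : affine_scope.
Notation "a ⊗ b" := (atens a b)
  (at level 40, left associativity) : affine_scope.
Notation "a ⊸ b" := (alolli a b)
  (at level 55, right associativity) : affine_scope.
Notation "∀ x .. y , P" := (aall (fun x => .. (aall (fun y => P)) ..))
  (at level 200, x binder, y binder, right associativity) : affine_scope.
Notation "∃ x .. y , P" := (aex (fun x => .. (aex (fun y => P)) ..))
  (at level 200, x binder, y binder, right associativity) : affine_scope.
Notation "a ⊢ b" := (entails a b) (at level 70, no associativity) :
  affine_scope.
Notation "⊢ a" := (entails atop a) (at level 70) : affine_scope.
Notation "⨂_ ( i < n ) F" := (\big[@atens _/atop]_(i < n) F)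
  (at level 41, i at level 0, n at level 50, F at level 41) : affine_scope.

(* The affine proposition of a decidable statement, such as the order of the
   rationals. *)
Definition adec (L : affineLogic) (b : bool) : L := if b then ⊤ else ⊥.

Definition pset (L : affineLogic) (X : Type) := X -> L.

Section Sets.
Variables (L : affineLogic) (X : Type).
Implicit Types s t : pset L X.

Definition asub s t : L := ∀ x, s x ⊸ t x.
Definition acompl s : pset L X := fun x => ¬ s x.
Definition aboxtimes s t : pset L X := fun x => s x ⊗ t x.
Definition asqcap s t : pset L X := fun x => awith (s x) (t x).
Definition afull : pset L X := fun=> ⊤.
Definition apreim (Y : Type) (f : Y -> X) t : pset L Y := fun y => t (f y).
End Sets.

Arguments afull {L X}.
Infix "⊆" := asub (at level 50, no associativity) : affine_scope.
Infix "⊠" := aboxtimes (at level 40, left associativity) : affine_scope.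
Infix "⊓" := asqcap (at level 40, left associativity) : affine_scope.

Record topSpace (L : affineLogic) := TopSpace {
  points :> Type;
  interior : pset L points -> pset L points;
  interior_sub : ⊢ ∀ s, interior s ⊆ s;
  interior_mono : ⊢ ∀ s t, (s ⊆ t) ⊸ (interior s ⊆ interior t);
  interior_idem : ⊢ ∀ s, interior s ⊆ interior (interior s);
  interior_full : ⊢ afull ⊆ interior afull;
  interior_cap : ⊢ ∀ s t, interior s ⊠ interior t ⊆ interior (s ⊓ t)
}.

Definition tclosure (L : affineLogic) (X : topSpace L) (s : pset L X) :
  pset L X := acompl (interior (acompl s)).

Definition Fil (L : affineLogic) (X : Type) (F : pset L (pset L X)) : L :=
  abang ((∀ s t : pset L X, F s ⊸ (s ⊆ t) ⊸ F t)
         ⊗ F afull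
         ⊗ (∀ s t : pset L X, F s ⊗ F t ⊸ F (s ⊠ t))).

Definition Cpt (L : affineLogic) (X : topSpace L) (s : pset L X) : L :=
  ∀ F : pset L (pset L X),
    Fil F ⊸ ¬ F (acompl s) ⊸
    ∃ x : X, s x ⊗ abang (∀ t : pset L X, F t ⊸ tclosure t x).

Definition Conti (L : affineLogic) (X Y : topSpace L) (f : X -> Y) : L :=
  ∀ t : pset L Y, apreim f (interior t) ⊆ interior (apreim f t).

(* The subtype of P(Q) cut out by the two conditions: an element is a subset
   for which they are theorems. *)
Record cut (L : affineLogic) := Cut {
  cutL :> pset L rat;
  cut_lower : ⊢ ∀ a b : rat, adec L (a < b)%R ⊗ cutL b ⊸ cutL a;
  cut_open : ⊢ ∀ a : rat, cutL a ⊸ ∃ b : rat, adec L (a < b)%R ⊗ cutL b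
}.

Definition cut_le (L : affineLogic) (x y : cut L) : L := cutL x ⊆ cutL y.
Definition cut_lt (L : affineLogic) (x y : cut L) : L := ¬ cut_le y x.

Section EntailmentFacts.
Variable L : affineLogic.
Implicit Types a b c d : L.

Lemma alolli_intro a b : a ⊢ b -> ⊢ a ⊸ b.
Proof. by move=> ab; apply/alolliP; apply: entails_trans (atens1E a) ab. Qed.

Lemma atens_projr a b : a ⊗ b ⊢ b.
Proof.
exact: entails_trans (atensS (atopI a) (entails_refl b)) (atens1E b).
Qed.

Lemma atens_projl a b : a ⊗ b ⊢ a.
Proof. exact: entails_trans (atensC a b) (atens_projr b a). Qed.

Lemma atensAr a b c : a ⊗ b ⊗ c ⊢ a ⊗ (b ⊗ c).
Proof.
apply: entails_trans (atensC _ _) _; apply: entails_trans (atensA _ _ _) _.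
apply: entails_trans (atensC _ _) _; apply: entails_trans (atensA _ _ _) _.
exact: atensC.
Qed.

Lemma atensCA a b c : a ⊗ (b ⊗ c) ⊢ b ⊗ (a ⊗ c).
Proof.
apply: entails_trans (atensA _ _ _) _.
by apply: entails_trans (atensAr _ _ _); apply: atensS (atensC _ _) _;
  apply: entails_refl.
Qed.

Lemma atensACA a b c d : a ⊗ b ⊗ (c ⊗ d) ⊢ a ⊗ c ⊗ (b ⊗ d).
Proof.
apply: entails_trans (atensAr _ _ _) _; apply: entails_trans (atensA _ _ _).
by apply: atensS (atensCA _ _ _); apply: entails_refl.
Qed.

Lemma aneg_mono a b : a ⊢ b -> ¬ b ⊢ ¬ a.
Proof.
move=> ab; apply/alolliP.
apply: entails_trans (atensS (entails_refl _) ab) _.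
by apply/alolliP; apply: entails_refl.
Qed.

Lemma aex_intro (I : Type) (P : I -> L) i : P i ⊢ aex P.
Proof. exact: (proj1 (aexP P _) (entails_refl _)). Qed.

Lemma aex_elim (I : Type) (P : I -> L) c d :
  (forall i, c ⊗ P i ⊢ d) -> c ⊗ aex P ⊢ d.
Proof.
move=> Pd; apply: entails_trans (atensC _ _) _; apply/alolliP/aexP => i.
by apply/alolliP; apply: entails_trans (atensC _ _) (Pd i).
Qed.

Lemma adec_mono (b1 b2 : bool) : (b1 -> b2) -> adec L b1 ⊢ adec L b2.
Proof.
case: b1 b2 => [] [] // imp; try exact: entails_refl; first by have := imp isT.
exact: atopI.
Qed.

Lemma adec_elim (b : bool) c d : (b -> c ⊢ d) -> adec L b ⊗ c ⊢ d.
Proof.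
case: b => [cd|_]; first exact: entails_trans (atens1E c) (cd isT).
apply: entails_trans (atens_projl _ _) _; apply: entails_trans (adnegE d).
by apply/alolliP; apply: atens_projl.
Qed.

Lemma asub_intro (X : Type) (s t : pset L X) c :
  (forall x, c ⊗ s x ⊢ t x) -> c ⊢ s ⊆ t.
Proof. by move=> st; apply/aallP => x; apply/alolliP. Qed.

Lemma asub_elim (X : Type) (s t : pset L X) x : (s ⊆ t) ⊗ s x ⊢ t x.
Proof.
by apply/alolliP; apply: (proj1 (aallP _ _) (entails_refl _) x).
Qed.

Lemma asub_trans (X : Type) (s t u : pset L X) : (t ⊆ u) ⊗ (s ⊆ t) ⊢ s ⊆ u.
Proof.
apply: asub_intro => x; apply: entails_trans (atensAr _ _ _) _.
by apply: entails_trans (asub_elim t u x); apply: atensS (asub_elim _ _ _);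
  apply: entails_refl.
Qed.

End EntailmentFacts.

Section CutTopology.
Variable L : affineLogic.

Lemma cutq_lower (q : rat) :
  ⊢ ∀ a b : rat, adec L (a < b)%R ⊗ adec L (b < q)%R ⊸ adec L (a < q)%R.
Proof.
apply/aallP => a; apply/aallP => b; apply: alolli_intro; apply: adec_elim => ab.
by apply: adec_mono; apply: lt_trans.
Qed.

Lemma cutq_open (q : rat) :
  ⊢ ∀ a : rat, adec L (a < q)%R ⊸
       ∃ b : rat, adec L (a < b)%R ⊗ adec L (b < q)%R.
Proof.
apply/aallP => a; apply: alolli_intro; apply: entails_trans (atens1I _) _.
apply: entails_trans (atensC _ _) _; apply: adec_elim => aq.
apply: entails_trans (aex_intro (fun b => _) ((a + q) / 2%:R)%R).
by rewrite !midf_lt //; apply: atens1I.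
Qed.

Definition cutq (q : rat) : cut L := Cut (cutq_lower q) (cutq_open q).

(* Open intervals with endpoints in Q + {-oo} and Q + {+oo}: [None] is -oo as a
   left endpoint and +oo as a right endpoint. *)
Definition interval_ends := (option rat * option rat)%type.

Definition lend_lt (a : option rat) (x : cut L) : L :=
  if a is Some q then cut_lt (cutq q) x else ⊤.
Definition lt_rend (x : cut L) (b : option rat) : L :=
  if b is Some q then cut_lt x (cutq q) else ⊤.

Definition oitv (ab : interval_ends) : pset L (cut L) :=
  fun x => lend_lt ab.1 x ⊗ lt_rend x ab.2.

Definition cut_interior (s : pset L (cut L)) : pset L (cut L) :=
  fun x => ∃ ab : interval_ends, oitv ab x ⊗ (oitv ab ⊆ s).

Lemma cutq_mono (q r : rat) : (q <= r)%R -> ⊢ cut_le (cutq q) (cutq r).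
Proof.
move=> qr; apply: asub_intro => p; apply: entails_trans (atens1E _) _.
by apply: adec_mono => /lt_le_trans; apply.
Qed.

Lemma lend_mono (q r : rat) x : (q <= r)%R ->
  lend_lt (Some r) x ⊢ lend_lt (Some q) x.
Proof.
move=> qr; apply: aneg_mono; apply: entails_trans (atens1I _) _.
apply: entails_trans (asub_trans _ _ _).
by apply: atensS (cutq_mono qr) (entails_refl _).
Qed.

Lemma rend_mono (q r : rat) x : (q <= r)%R ->
  lt_rend x (Some q) ⊢ lt_rend x (Some r).
Proof.
move=> qr; apply: aneg_mono; apply: entails_trans (atens1I _) _.
apply: entails_trans (atensC _ _) _.
apply: entails_trans (asub_trans _ _ _).
by apply: atensS (entails_refl _) (cutq_mono qr).
Qed.

Definition lend_max (a b : option rat) : option rat :=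
  match a, b with
  | Some q, Some r => Some (Num.max q r)
  | Some q, None => Some q
  | None, _ => b
  end.
Definition rend_min (a b : option rat) : option rat :=
  match a, b with
  | Some q, Some r => Some (Num.min q r)
  | Some q, None => Some q
  | None, _ => b
  end.
Definition itv_cap (I J : interval_ends) : interval_ends :=
  (lend_max I.1 J.1, rend_min I.2 J.2).

Lemma oitv_cap I J x : oitv I x ⊗ oitv J x ⊢ oitv (itv_cap I J) x.
Proof.
apply: entails_trans (atensACA _ _ _ _) _; apply: atensS.
  case: I J => [[q|] ?] [[r|] ?] /=; try exact: atens_projl;
    try exact: atens_projr.
  by case: (leP q r) => _; [apply: atens_projr | apply: atens_projl].
case: I J => [? [q|]] [? [r|]] /=; try exact: atens_projl;
  try exact: atens_projr.
by case: (leP q r) => _; [apply: atens_projl | apply: atens_projr].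
Qed.

Lemma itv_capl I J x : oitv (itv_cap I J) x ⊢ oitv I x.
Proof.
apply: atensS.
  case: I J => [[q|] ?] [[r|] ?]; try exact: atopI; last exact: entails_refl.
  by apply: lend_mono; rewrite le_max lexx.
case: I J => [? [q|]] [? [r|]]; try exact: atopI; last exact: entails_refl.
by apply: rend_mono; rewrite ge_min lexx.
Qed.

Lemma itv_capr I J x : oitv (itv_cap I J) x ⊢ oitv J x.
Proof.
apply: atensS.
  case: I J => [[q|] ?] [[r|] ?]; try exact: atopI; last exact: entails_refl.
  by apply: lend_mono; rewrite le_max lexx orbT.
case: I J => [? [q|]] [? [r|]]; try exact: atopI; last exact: entails_refl.
by apply: rend_mono; rewrite ge_min lexx orbT.
Qed.

Lemma cut_interior_sub : ⊢ ∀ s, cut_interior s ⊆ s.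
Proof.
apply/aallP => s; apply: asub_intro => x; apply: aex_elim => I.
apply: entails_trans (atens_projr _ _) _; apply: entails_trans (atensC _ _) _.
exact: asub_elim.
Qed.

Lemma cut_interior_mono :
  ⊢ ∀ s t, (s ⊆ t) ⊸ (cut_interior s ⊆ cut_interior t).
Proof.
apply/aallP => s; apply/aallP => t; apply: alolli_intro.
apply: asub_intro => x; apply: aex_elim => I.
apply: entails_trans (aex_intro (fun I => _) I).
apply: entails_trans (atensCA _ _ _) _.
exact: atensS (entails_refl _) (asub_trans _ _ _).
Qed.

Lemma cut_interior_idem :
  ⊢ ∀ s, cut_interior s ⊆ cut_interior (cut_interior s).
Proof.
apply/aallP => s; apply: asub_intro => x; apply: aex_elim => I.
apply: entails_trans (atens_projr _ _) _.
apply: entails_trans (aex_intro (fun I => _) I).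
apply: atensS (entails_refl _) _; apply: asub_intro => y.
apply: entails_trans (aex_intro (fun I => _) I); exact: atensC.
Qed.

Lemma cut_interior_full : ⊢ afull ⊆ cut_interior afull.
Proof.
apply: asub_intro => x; apply: entails_trans (aex_intro (fun I => _) (None, None)).
apply: atensS; first exact: atens1I.
by apply: asub_intro => y; apply: atopI.
Qed.

Lemma cut_interior_cap :
  ⊢ ∀ s t, cut_interior s ⊠ cut_interior t ⊆ cut_interior (s ⊓ t).
Proof.
apply/aallP => s; apply/aallP => t; apply: asub_intro => x.
apply: entails_trans (atens_projr _ _) _; apply: aex_elim => J.
apply: entails_trans (atensC _ _) _; apply: aex_elim => I.
apply: entails_trans (aex_intro (fun I => _) (itv_cap J I)).
apply: entails_trans (atensACA _ _ _ _) _; apply: atensS (oitv_cap _ _ _) _.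
apply: asub_intro => y; apply/awithP; split.
  apply: entails_trans (asub_elim (oitv I) s y).
  by apply: atensS (atens_projr _ _) (itv_capr _ _ _).
apply: entails_trans (asub_elim (oitv J) t y).
by apply: atensS (atens_projl _ _) (itv_capl _ _ _).
Qed.

Definition cut_space : topSpace L :=
  @TopSpace L (cut L) cut_interior cut_interior_sub cut_interior_mono
    cut_interior_idem cut_interior_full cut_interior_cap.

End CutTopology.

(* Main.v *)
Require Import Defs.
From mathcomp Require Import all_boot all_order all_algebra.
Set Implicit Arguments.
Unset Strict Implicit.
Unset Printing Implicit Defensive.
Local Open Scope affine_scope.

(** Consider the filter generated by the sets {y | f x <= f y} for x in s.
    That s is not disjoint from it is exactly the directedness hypothesis, used
    once, so compactness yields a cluster point x' in s.  If f x' < f x, there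
    are rationals q < r with q not in f x' and r in f x; then f x' lies in
    (-oo, r), which is contained in {z | z < f x}, so by continuity x' is
    interior to {y | f y < f x}.  This contradicts x' being in the closure of
    {y | f x <= f y}.  Every linear hypothesis is consumed exactly once. *)

Section AffineRules.
Variable L : affineLogic.
Implicit Types a b c : L.

Lemma aall_elim (I : Type) (P : I -> L) i : aall P ⊢ P i.
Proof. exact: (proj1 (aallP _ _) (entails_refl _) i). Qed.

Lemma acurry a b c : a ⊗ b ⊢ c -> a ⊢ b ⊸ c.
Proof. by case: (alolliP a b c). Qed.

Lemma auncurry a b c : a ⊢ b ⊸ c -> a ⊗ b ⊢ c.
Proof. by case: (alolliP a b c). Qed.

Lemma amp a b : (a ⊸ b) ⊗ a ⊢ b.
Proof. by apply: auncurry; apply: entails_refl. Qed.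

Lemma alolli_entails a b : ⊢ a ⊸ b -> a ⊢ b.
Proof. by move/auncurry; apply: entails_trans; apply: atens1I. Qed.

Lemma atens_cut_l a b c : ⊢ a -> a ⊗ b ⊢ c -> b ⊢ c.
Proof.
move=> ha; apply: entails_trans; apply: entails_trans (atens1I b) _.
exact: atensS ha (entails_refl _).
Qed.

Lemma aneg_aneg_intro a : a ⊢ ¬ ¬ a.
Proof. by apply: acurry; apply: entails_trans (atensC _ _) (amp _ _). Qed.

Lemma aneg_contra a b c : c ⊗ ¬ b ⊢ ¬ a -> c ⊗ a ⊢ b.
Proof.
move=> h; apply: entails_trans (adnegE b); apply: acurry.
apply: entails_trans (atensAr _ _ _) _.
apply: entails_trans (atensS (entails_refl _) (atensC _ _)) _.
by apply: entails_trans (atensA _ _ _) _; apply: auncurry.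
Qed.

Lemma aneg_alolli a b : ¬ (a ⊸ b) ⊢ a ⊗ ¬ b.
Proof.
apply: entails_trans (adnegE _); apply: aneg_mono; apply: acurry.
apply: entails_trans (adnegE b); apply: acurry.
by apply: entails_trans (atensAr _ _ _) (amp _ _).
Qed.

(** Involutivity of negation makes the quantifiers De Morgan dual, so a refuted universal yields a
    witness. This is what extracts a rational from a strict inequality of cuts. *)
Lemma aneg_aall (I : Type) (P : I -> L) : ¬ (∀ i, P i) ⊢ ∃ i, ¬ P i.
Proof.
apply: entails_trans (adnegE _); apply: aneg_mono; apply/aallP => i.
apply: entails_trans (adnegE _); apply: aneg_mono.
exact: (aex_intro (fun i => ¬ P i)).
Qed.

Lemma abang_mono a b : a ⊢ b -> abang a ⊢ abang b.
Proof. by move=> ab; apply: abang_promote; apply: entails_trans (abangE a) ab. Qed.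

Lemma abang_intro a : ⊢ a -> ⊢ abang a.
Proof. by move=> ha; apply: entails_trans (abang_top L) (abang_mono ha). Qed.

(* The tensor is a monoid only up to mutual entailment, so [big_cat] does not
   apply. *)
Lemma atens_big_cat (I : Type) (F : I -> L) (l k : seq I) :
  \big[@atens L/⊤]_(i <- l) F i ⊗ \big[@atens L/⊤]_(i <- k) F i
  ⊢ \big[@atens L/⊤]_(i <- l ++ k) F i.
Proof.
elim: l => [|i l ih]; first by rewrite big_nil; apply: atens1E.
rewrite cat_cons !big_cons; apply: entails_trans (atensAr _ _ _) _.
exact: atensS (entails_refl _) ih.
Qed.

Lemma atens_big_uncat (I : Type) (F : I -> L) (l k : seq I) :
  \big[@atens L/⊤]_(i <- l ++ k) F i
  ⊢ \big[@atens L/⊤]_(i <- l) F i ⊗ \big[@atens L/⊤]_(i <- k) F i.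
Proof.
elim: l => [|i l ih]; first by rewrite big_nil; apply: atens1I.
rewrite cat_cons !big_cons; apply: entails_trans (atensA _ _ _).
exact: atensS (entails_refl _) ih.
Qed.

End AffineRules.

Section GeneratedFilter.
Variables (L : affineLogic) (I X : Type) (s : pset L I) (R : I -> pset L X).

Definition big_boxtimes (l : seq I) : pset L X :=
  fun y => \big[@atens L/⊤]_(i <- l) R i y.

(** Lists, with repetitions, replace finite sets of generators: without contraction, each use of a
    generator is paid for by its own copy of [s i]. *)
Definition filter_gen : pset L (pset L X) :=
  fun t => ∃ l : seq I, \big[@atens L/⊤]_(i <- l) s i ⊗ (big_boxtimes l ⊆ t).

Lemma filter_gen_base i : s i ⊢ filter_gen (R i).
Proof.
apply: entails_trans (aex_intro _ [:: i]).
apply: entails_trans (atens1I _) _; apply: entails_trans (atensC _ _) _.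
apply: atensS.
  rewrite big_cons big_nil.
  by apply: entails_trans (atens1I _) (atensC _ _).
apply: asub_intro => y; apply: entails_trans (atens1E _) _.
by rewrite /big_boxtimes big_cons; apply: atens_projl.
Qed.

Lemma Fil_filter_gen : ⊢ Fil filter_gen.
Proof.
apply: abang_intro; apply: entails_trans (atens1I _) _; apply: atensS.
  apply: entails_trans (atens1I _) _; apply: atensS.
    apply/aallP => t; apply/aallP => u; apply: alolli_intro; apply: acurry.
    apply: entails_trans (atensC _ _) _; apply: aex_elim => l.
    apply: entails_trans (aex_intro _ l).
    apply: entails_trans (atensCA _ _ _) _.
    exact: atensS (entails_refl _) (asub_trans _ _ _).
  apply: entails_trans (aex_intro _ [::]).
  apply: entails_trans (atens1I _) _; apply: atensS.
    by rewrite big_nil; apply: entails_refl.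
  by apply: asub_intro => y; apply: atopI.
apply/aallP => t; apply/aallP => u; apply: alolli_intro.
apply: aex_elim => k; apply: entails_trans (atensC _ _) _; apply: aex_elim => l.
apply: entails_trans (atensC _ _) _.
(* Concatenation pools the resources of both lists, and membership in the longer product splits into
   membership in each factor. *)
apply: entails_trans (aex_intro _ (l ++ k)).
apply: entails_trans (atensACA _ _ _ _) _.
apply: atensS (atens_big_cat _ _ _) _.
apply: asub_intro => y.
apply: entails_trans (atensS (entails_refl _) (atens_big_uncat _ _ _)) _.
apply: entails_trans (atensACA _ _ _ _) _.
exact: atensS (asub_elim _ _ _) (asub_elim _ _ _).
Qed.

(** Directedness, applied to the list that witnesses membership, gives a point of [u] in
    [big_boxtimes l], which is contained in the complement of [u]. *)
Lemma filter_gen_proper (u : pset L X) :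
  (∀ (n : nat) (xs : 'I_n -> I),
     ⨂_(i < n) s (xs i) ⊸ ∃ y : X, u y ⊗ ⨂_(i < n) R (xs i) y)
  ⊢ ¬ filter_gen (acompl u).
Proof.
apply: acurry; apply: aex_elim => l; apply: entails_trans (atensA _ _ _) _.
apply: auncurry; apply: (entails_trans (∃ y : X, u y ⊗ big_boxtimes l y)).
  (* The list is read as a family indexed by ['I_(size l)], the form the hypothesis asks for. *)
  apply: auncurry; apply: entails_trans (aall_elim _ (size l)) _.
  apply: entails_trans (aall_elim _ (tnth (in_tuple l))) _.
  rewrite -(big_tnth _ _ l xpredT s); apply: acurry; apply: entails_trans (amp _ _) _.
  apply/aexP => y; apply: entails_trans (aex_intro _ y).
  by rewrite -(big_tnth _ _ l xpredT (fun i => R i y)); apply: entails_refl.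
apply/aexP => y; apply: acurry; apply: entails_trans (atensAr _ _ _) _.
apply: entails_trans (atensS (entails_refl _) (atensC _ _)) _.
apply: entails_trans (atensS (entails_refl _) (asub_elim _ _ _)) _.
exact: entails_trans (atensC _ _) (amp _ _).
Qed.

End GeneratedFilter.

Section Cuts.
Variable L : affineLogic.
Implicit Types x y z : cut L.

Lemma cut_lt_elim x y : cut_lt x y ⊢ ∃ q : rat, cutL y q ⊗ ¬ cutL x q.
Proof.
apply: entails_trans (aneg_aall _) _; apply/aexP => q.
by apply: entails_trans (aex_intro _ q); apply: aneg_alolli.
Qed.

Lemma cutq_le_mem x (r : rat) : cutL x r ⊢ cut_le (cutq L r) x.
Proof.
apply: asub_intro => p; apply: entails_trans (atensC _ _) _.
apply: alolli_entails; apply: entails_trans (cut_lower x) _.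
by apply: entails_trans (aall_elim _ p) _; apply: aall_elim.
Qed.

Lemma lt_cutq x (q r : rat) : (q < r)%R -> ¬ cutL x q ⊢ cut_lt x (cutq L r).
Proof.
move=> qr; apply: aneg_mono; apply: entails_trans (aall_elim _ q) _.
apply: entails_trans (atens1I _) _; apply: entails_trans (atensC _ _) _.
by rewrite /= /adec qr; apply: amp.
Qed.

(** By contraposition: from [r] in [y] comes r ≤ y, and with y ≤ z transitivity gives r ≤ z, against
    z < r. *)
Lemma ray_sub_lt y (r : rat) :
  cutL y r ⊢ oitv (None, Some r) ⊆ (fun z => cut_lt z y).
Proof.
apply: asub_intro => z.
apply: entails_trans (atensS (entails_refl _) (atens_projr _ _)) _.
apply: aneg_contra.
apply: entails_trans (atensS (entails_refl _) (adnegE _)) _.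
apply: entails_trans (atensS (cutq_le_mem y r) (entails_refl _)) _.
apply: entails_trans (aneg_aneg_intro _).
by apply: entails_trans (atensC _ _) (asub_trans _ _ _).
Qed.

Lemma cut_lt_interior x y :
  cut_lt x y ⊢ cut_interior (fun z => cut_lt z y) x.
Proof.
apply: entails_trans (cut_lt_elim x y) _; apply/aexP => q.
apply: entails_trans (atensC _ _) _.
(* Openness of [y] moves its member [q] up to some r > q. Then [¬ cutL x q] is spent on x < r and
   [cutL y r] on the inclusion of the ray below [r]. *)
have yo : cutL y q ⊢ ∃ r : rat, adec L (q < r)%R ⊗ cutL y r.
  apply: alolli_entails; apply: entails_trans (cut_open y) _.
  exact: aall_elim.
apply: entails_trans (atensS (entails_refl _) yo) _; apply: aex_elim => r.
apply: entails_trans (atensCA _ _ _) _; apply: adec_elim => qr.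
apply: entails_trans (aex_intro _ (None, Some r)).
apply: atensS (ray_sub_lt y r).
by apply: entails_trans (lt_cutq x qr) _; apply: atens1I.
Qed.

End Cuts.

(** Since [cut_lt z y] unfolds to the negation of [cut_le y z], the complement whose interior
    defines this closure is the preimage under [f] of the open set {z | z < y}. *)
Lemma Conti_closure_le (L : affineLogic) (X : topSpace L)
    (f : X -> cut_space L) (y : cut L) (x' : X) :
  tclosure (fun x => cut_le y (f x)) x' ⊗ Conti f ⊢ cut_le y (f x').
Proof.
apply: entails_trans (atensC _ _) _; apply: aneg_contra.
apply: entails_trans (aneg_aneg_intro _).
apply: entails_trans (atensS (entails_refl _) (cut_lt_interior (f x') y)) _.
apply: entails_trans (asub_elim (apreim f (cut_interior _)) _ x').
apply: atensS (entails_refl _).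
exact: aall_elim.
Qed.

Theorem theorem28 (L : affineLogic) (X : topSpace L) (s : pset L X)
    (f : X -> cut_space L) :
  ⊢ Cpt s
    ⊗ (∀ (n : nat) (xs : 'I_n -> X),
         ⨂_(i < n) s (xs i)
         ⊸ ∃ x' : X, s x' ⊗ ⨂_(i < n) cut_le (f (xs i)) (f x'))
    ⊸ ∃ x' : X,
        s x' ⊗ abang (∀ x : X, s x ⊸ Conti f ⊸ cut_le (f x) (f x')).
Proof.
pose R (x : X) : pset L X := fun y => cut_le (f x) (f y).
apply: alolli_intro.
apply: entails_trans
  (atensS (entails_refl _) (filter_gen_proper s R s)) _.
apply: auncurry; apply: entails_trans (aall_elim _ (filter_gen s R)) _.
apply: (atens_cut_l (Fil_filter_gen s R)).
apply: entails_trans (atensC _ _) _; apply: entails_trans (amp _ _) _.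
apply: acurry; apply: entails_trans (amp _ _) _; apply/aexP => x'.
apply: entails_trans (aex_intro _ x'); apply: atensS (entails_refl _) _.
(* The cluster property already stands under [!], so monotonicity suffices. [s x] and [Conti f]
   enter inside it: the first puts [R x] in the filter, the second turns closure into an
   inequality. *)
apply: abang_mono; apply/aallP => x; apply: acurry; apply: acurry.
apply: entails_trans (Conti_closure_le f (f x) x').
apply: atensS (entails_refl _).
apply: entails_trans (atensS (entails_refl _) (filter_gen_base s R x)) _.
by apply: auncurry; apply: aall_elim.
Qed.
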